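(* Let $k\geq 1$ and let $G$ be a graph on $n$ vertices with $\operatorname{ppt}_k(G)=n-2$. Then $G\in \{K_1\cup K_1,\ K_1\cup K_2,\ P_3,\ P_4,\ C_3,\ C_4\}$.
   Context: All graphs are finite and simple, and are not assumed to be connected; membership of graphs in a list is up to isomorphism. $P_n$, $C_n$, $K_n$ denote the path, cycle and complete graph on $n$ vertices, and $\cup$ denotes disjoint union of graphs. For a graph $G$ and $S\subseteq V(G)$, let $N(v)$ be the set of neighbors of $v$ and $N[S]=S\cup\bigcup_{s\in S}N(s)$. Define $S^{[0]}=S$, $S^{[1]}=N[S]$, and for $t\geq 1$, $S^{[t+1]}=S^{[t]}\cup\{w\in V(G) : \exists\, v\in S^{[t]},\ w\in N(v)\setminus S^{[t]} \text{ and } |N(v)\setminus S^{[t]}|\leq k\}$. The set $S$ is a $k$-power dominating set of $G$ if $S^{[\ell]}=V(G)$ for some $\ell$; a minimum $k$-power dominating set is one of minimum cardinality. For a $k$-power dominating set $S$, $\operatorname{ppt}_k(G,S)$ is the smallest $\ell\geq 0$ with $S^{[\ell]}=V(G)$. The $k$-power propagation time of $G$ is $\operatorname{ppt}_k(G)=\min\{\operatorname{ppt}_k(G,S) : S \text{ is a minimum } k\text{-power dominating set of } G\}$. *)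

(* Defs.v *)
From mathcomp Require Import all_boot.
From mathcomp Require Import boolp.

Set Implicit Arguments.
Unset Strict Implicit.
Unset Printing Implicit Defensive.

Record sgraph := SGraph {
  vertex :> finType;
  adj : rel vertex;
  adj_sym : symmetric adj;
  adj_irrefl : irreflexive adj
}.

Definition isomorphic (G H : sgraph) : Prop :=
  exists2 f : G -> H, bijective f & forall x y, adj (f x) (f y) = adj x y.

Section Families.
Variable n : nat.

Definition path_adj (i j : 'I_n) : bool := (i.+1 == j) || (j.+1 == i).

Fact path_adj_sym : symmetric path_adj.
Proof. by move=> i j; rewrite /path_adj orbC. Qed.

Fact path_adj_irrefl : irreflexive path_adj.
Proof. by move=> i; rewrite /path_adj orbb gtn_eqF. Qed.

Definition path_graph : sgraph := SGraph path_adj_sym path_adj_irrefl.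

(* This is the cycle on n vertices only when n >= 3. *)
Definition cycle_adj (i j : 'I_n) : bool :=
  (i != j) && ((i.+1 %% n == j) || (j.+1 %% n == i)).

Fact cycle_adj_sym : symmetric cycle_adj.
Proof. by move=> i j; rewrite /cycle_adj eq_sym orbC. Qed.

Fact cycle_adj_irrefl : irreflexive cycle_adj.
Proof. by move=> i; rewrite /cycle_adj eqxx. Qed.

Definition cycle_graph : sgraph := SGraph cycle_adj_sym cycle_adj_irrefl.

Definition complete_adj (i j : 'I_n) : bool := i != j.

Fact complete_adj_sym : symmetric complete_adj.
Proof. by move=> i j; rewrite /complete_adj eq_sym. Qed.

Fact complete_adj_irrefl : irreflexive complete_adj.
Proof. by move=> i; rewrite /complete_adj eqxx. Qed.

Definition complete_graph : sgraph :=
  SGraph complete_adj_sym complete_adj_irrefl.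

End Families.

Section DisjointUnion.
Variables G H : sgraph.

Definition disjoint_union_adj (u v : G + H) : bool :=
  match u, v with
  | inl x, inl y => adj x y
  | inr x, inr y => adj x y
  | _, _ => false
  end.

Fact disjoint_union_adj_sym : symmetric disjoint_union_adj.
Proof. by move=> [x|x] [y|y] //=; apply: adj_sym. Qed.

Fact disjoint_union_adj_irrefl : irreflexive disjoint_union_adj.
Proof. by move=> [x|x] /=; apply: adj_irrefl. Qed.

Definition disjoint_union : sgraph :=
  SGraph disjoint_union_adj_sym disjoint_union_adj_irrefl.

End DisjointUnion.

Definition neighbors (G : sgraph) (v : G) : {set G} := [set w | adj v w].

Definition closed_neighborhood (G : sgraph) (S : {set G}) : {set G} :=
  S :|: \bigcup_(s in S) neighbors s.

Section PowerPropagation.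
Variables (k : nat) (G : sgraph).
Implicit Types S : {set G}.

Definition propagate S : {set G} :=
  S :|: [set w | [exists v in S, (w \in neighbors v :\: S)
                                 && (#|neighbors v :\: S| <= k)]].

(* [observed S t] is S^{[t]}: the first step dominates unconditionally, and
   only the later ones are subject to the bound k. *)
Fixpoint observed S (t : nat) : {set G} :=
  match t with
  | 0 => S
  | t'.+1 => if t' is 0 then closed_neighborhood S
             else propagate (observed S t')
  end.

Definition power_dominating S : Prop :=
  exists l, observed S l == [set: G].

Definition min_power_dominating S : Prop :=
  power_dominating S /\
  forall S', power_dominating S' -> #|S| <= #|S'|.

Definition ppt_set S (domS : power_dominating S) : nat := ex_minn domS.

Fact min_power_dominating_exists : exists S, min_power_dominating S.
Proof.
have domT : `[< power_dominating [set: G] >] by apply/asboolP; exists 0 => /=.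
case: (@arg_minnP _ [set: G] (fun S => `[< power_dominating S >])
         (fun S => #|S|) domT) => S /asboolP domS minS.
by exists S; split=> // S' domS'; apply/minS/asboolP.
Qed.

Definition ppt_value (l : nat) : Prop :=
  exists S (minS : min_power_dominating S), ppt_set minS.1 = l.

Fact ppt_value_exists : exists l, `[< ppt_value l >].
Proof.
have [S minS] := min_power_dominating_exists.
by exists (ppt_set minS.1); apply/asboolP; exists S, minS.
Qed.

Definition ppt : nat := ex_minn ppt_value_exists.

End PowerPropagation.

(* Main.v *)
Require Import Defs.
From mathcomp Require Import all_boot.
From mathcomp Require Import boolp.

(** Let [S] be a minimum power dominating set realizing T = ppt_k(G), where
    T + 2 is the number of vertices. Each of the T steps observes at least
    one new vertex, so S^[t] has at most t + 2 vertices for t <= T: there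
    are at most two sources; with two of them every step observes exactly one
    vertex, and with only one of them at most one step observes two
    ([optimal_card_le]).

    Against this rigidity stands monotonicity: if S^[s] is contained in S'^[t]
    with s, t >= 1, then the propagation from S' stays ahead of the one from S
    for ever. Hence no set with at most |S| vertices can reach S^[s] in t steps
    when 1 <= t < s <= T ([no_shortcut]), and no smaller set can reach it at all
    ([no_smaller]). Everything else consists in exhibiting such a better
    set when G is too large.

    With two sources, unless they are the whole graph, the first step observes
    a single vertex v, adjacent to one source a only, the other source b being
    isolated; {v, b} would save a step as soon as T >= 2
    ([two_sources_isomorphic]).

    With one source a, starting from its neighbor instead would save a step if
    a had degree one, so a has exactly two neighbors p and q
    ([one_source_degree2]), and from there on each step observes one vertex.
    If T >= 2, one of them, say p, forces a vertex w. If T >= 3, a further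
    vertex x is forced by w or by q, and one of {w}, {p}, {q} observes all of
    S^[3] in two steps ([one_source_ppt_le2]). So there are at most four
    vertices, and the adjacencies among a, p, q, w are read off directly. *)

Set Implicit Arguments.
Unset Strict Implicit.
Unset Printing Implicit Defensive.

(** * Monotonicity and stabilization of the propagation *)

Lemma in_closed_neighborhood (G : sgraph) (S : {set G}) w :
  (w \in closed_neighborhood S) = (w \in S) || [exists s in S, adj s w].
Proof.
rewrite inE; congr orb; apply/bigcupP/exists_inP => -[s sS];
  by rewrite ?inE => sw; exists s; rewrite ?inE.
Qed.

Lemma in_observed1 k (G : sgraph) (a w : G) :
  (w \in observed k [set a] 1) = (w == a) || adj a w.
Proof.
rewrite in_closed_neighborhood inE; congr orb.
by apply/exists_inP/idP => [[s /set1P-> //]|aw]; exists a; rewrite ?inE.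
Qed.

Lemma sub_observed1 k (G : sgraph) (S : {set G}) s : s \in S ->
  s \in observed k S 1.
Proof. by rewrite in_closed_neighborhood => ->. Qed.

Lemma adj_observed1 k (G : sgraph) (S : {set G}) s w : s \in S -> adj s w ->
  w \in observed k S 1.
Proof.
move=> sS sw; rewrite in_closed_neighborhood; apply/orP; right.
by apply/exists_inP; exists s.
Qed.

Lemma observedS k (G : sgraph) (S : {set G}) t : 0 < t ->
  observed k S t.+1 = propagate k (observed k S t).
Proof. by case: t. Qed.

Lemma sub_propagate k (G : sgraph) (A : {set G}) : A \subset propagate k A.
Proof. exact: subsetUl. Qed.

Lemma propagate_newP k (G : sgraph) (A : {set G}) w :
  w \in propagate k A -> w \notin A ->
  exists v, [/\ v \in A, adj v w & #|neighbors v :\: A| <= k].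
Proof.
rewrite !inE => /orP[-> //|/exists_inP[v vA]].
by rewrite !inE => /andP[/andP[_ vw] le_k] _; exists v.
Qed.

Lemma mem_propagate k (G : sgraph) (A : {set G}) v w :
  v \in A -> adj v w -> #|neighbors v :\: A| <= k -> w \in propagate k A.
Proof.
move=> vA vw le_k; rewrite !inE; case: (boolP (w \in A)) => //= wA.
by apply/exists_inP; exists v; rewrite // !inE wA vw.
Qed.

Lemma mem_propagate1 k (G : sgraph) (A : {set G}) v w :
  0 < k -> v \in A -> adj v w -> (forall z, adj v z -> z \notin A -> z = w) ->
  w \in propagate k A.
Proof.
move=> k_gt0 vA vw only_w; apply: (mem_propagate vA vw).
apply: leq_trans k_gt0; rewrite -(cards1 w); apply: subset_leq_card.
by apply/subsetP => z; rewrite !inE => /andP[zA vz]; rewrite (only_w z).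
Qed.

Lemma observed_newP k (G : sgraph) (S : {set G}) t w :
  0 < t -> w \in observed k S t.+1 -> w \notin observed k S t ->
  exists v, [/\ v \in observed k S t, adj v w
              & #|neighbors v :\: observed k S t| <= k].
Proof. by move=> t_gt0; rewrite observedS //; apply: propagate_newP. Qed.

(** A vertex of [A] has no more unobserved neighbors with respect to a larger
    set [B], so whatever it may force from [A], it may force from [B]. *)
Lemma propagate_mono k (G : sgraph) (A B : {set G}) :
  A \subset B -> propagate k A \subset propagate k B.
Proof.
move=> sAB; apply/subsetP => w wpA.
have [wA|wA] := boolP (w \in A).
  by rewrite (subsetP (sub_propagate k B)) // (subsetP sAB).
have [v [vA vw le_k]] := propagate_newP wpA wA.
apply: (mem_propagate (subsetP sAB _ vA) vw); apply: leq_trans le_k.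
by apply/subset_leq_card/setDS.
Qed.

(** The domination step obeys another rule than the later ones, hence the
    positivity conditions: [observed k S 0] may be contained in
    [observed k S' 1] without [S'] keeping ahead of [S]. *)
Lemma observed_mono k (G : sgraph) (S S' : {set G}) s t m :
  0 < s -> 0 < t -> observed k S s \subset observed k S' t ->
  observed k S (s + m) \subset observed k S' (t + m).
Proof.
move=> s_gt0 t_gt0 sub; elim: m => [|m IHm]; first by rewrite !addn0.
by rewrite !addnS !observedS ?addn_gt0 ?s_gt0 ?t_gt0 ?propagate_mono.
Qed.

Lemma observed_subS k (G : sgraph) (S : {set G}) t :
  observed k S t \subset observed k S t.+1.
Proof. by case: t => [|t]; exact: subsetUl. Qed.

Lemma observed_grow1 k (G : sgraph) (S : {set G}) t :
  #|observed k S t.+1| = #|observed k S t|.+1 ->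
  exists2 w, w \notin observed k S t
           & observed k S t.+1 = w |: observed k S t.
Proof.
move=> card1.
have /cards1P[w Dw] : #|observed k S t.+1 :\: observed k S t| == 1.
  by rewrite cardsD (setIidPr (observed_subS k S t)) card1 subSnn.
have Dnew z : (z \in observed k S t.+1) && (z \notin observed k S t) = (z == w).
  by rewrite andbC -in_setD Dw inE.
exists w; first by have /andP[] : _ := etrans (Dnew w) (eqxx w).
apply/setP => z; rewrite in_setU1 -Dnew.
have [zS|_] := boolP (z \in observed k S t); last by rewrite andbT orbF.
by rewrite (subsetP (observed_subS k S t)) ?orbT.
Qed.

(** For [t = 0] the hypothesis says that [S] has no neighbor outside itself, so
    that the forcing steps cannot get out of it either. *)
Lemma observed_stable k (G : sgraph) (S : {set G}) t m :
  observed k S t.+1 = observed k S t -> observed k S (t + m) = observed k S t.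
Proof.
move=> fix_t; elim: m => [|m IHm]; first by rewrite addn0.
rewrite addnS; case: t fix_t IHm => [|t] fix_t IHm; last first.
  by rewrite observedS ?addSn // -addSn IHm -observedS.
case: m IHm => [|m] IHm; first exact: fix_t.
rewrite observedS // IHm; apply/eqP; rewrite eqEsubset sub_propagate andbT.
apply/subsetP => w wp; apply: contraT => wS.
have [v [vS vw _]] := propagate_newP wp wS.
case/negP: wS; rewrite -fix_t /= in_closed_neighborhood; apply/orP; right.
by apply/exists_inP; exists v.
Qed.

(** * Sets that realize the propagation time *)

(** The two minimalities, of [#|S|] among power dominating sets and of [T] among
    their propagation times, are folded into one condition on competitors [S'],
    so that refuting optimality takes a single competitor. *)
Definition optimal k (G : sgraph) (S : {set G}) T : Prop :=
  observed k S T = setT /\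
  forall (S' : {set G}) t, #|S'| <= #|S| -> observed k S' t = setT ->
    #|S'| = #|S| /\ T <= t.

Lemma ppt_optimal k (G : sgraph) : exists S, @optimal k G S (ppt k G).
Proof.
rewrite /ppt; case: ex_minnP => _ /asboolP[S [minS <-]] min_l.
exists S; split.
  by rewrite /ppt_set; case: ex_minnP => l /eqP.
move=> S' t leS' S't; have domS' : power_dominating k S'.
  by exists t; apply/eqP.
have eqS : #|S'| = #|S| by apply/eqP; rewrite eqn_leq leS' minS.2.
have minS' : min_power_dominating k S'.
  by split=> // S''; rewrite eqS; apply: minS.2.
split=> //; apply: leq_trans (min_l (ppt_set minS'.1) _) _.
  by apply/asboolP; exists S', minS'.
by rewrite /ppt_set; case: ex_minnP => l _; apply; apply/eqP.
Qed.

(** A step without progress before time [T] would freeze the process, which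
    would then have finished earlier. *)
Lemma optimal_growth k (G : sgraph) (S : {set G}) T t :
  optimal k S T -> t < T -> #|observed k S t| < #|observed k S t.+1|.
Proof.
move=> [ST minT] ltT; apply/proper_card; rewrite properEneq observed_subS andbT.
apply/eqP => fix_t; have := observed_stable (T - t) (esym fix_t).
rewrite subnKC ?(ltnW ltT) // ST => /esym St.
by have [] := minT S t (leqnn _) St; rewrite leqNgt ltT.
Qed.

Lemma optimal_card k (G : sgraph) (S : {set G}) T s t :
  optimal k S T -> s <= t <= T ->
  #|observed k S s| + (t - s) <= #|observed k S t|.
Proof.
move=> opt; elim: t => [|t IHt]; first by case: s => // _; rewrite addn0.
case/andP; rewrite leq_eqVlt ltnS => /orP[/eqP->|le_st] ltT.
  by rewrite subnn addn0.
rewrite subSn // addnS; apply: leq_ltn_trans (optimal_growth opt ltT).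
by apply: IHt; rewrite le_st ltnW.
Qed.

(** After time [t] there remain [T - t] steps, each of which observes at least
    one of the [T + 2] vertices. *)
Lemma optimal_card_le k (G : sgraph) (S : {set G}) T t :
  optimal k S T -> T + 2 = #|G| -> t <= T -> #|observed k S t| <= t + 2.
Proof.
move=> opt cardG leT; have := optimal_card opt (s := t) (t := T).
rewrite leT leqnn (proj1 opt) cardsT -cardG => /(_ isT).
by rewrite -{2}(subnKC leT) addnAC leq_add2r.
Qed.

(** Once the propagation from [S'] has caught up with the one from [S], it
    covers the whole graph, and minimality of [S] applies. *)
Lemma no_smaller k (G : sgraph) (S S' : {set G}) T s t :
  optimal k S T -> 0 < s <= T -> 0 < t ->
  observed k S s \subset observed k S' t -> #|S| <= #|S'|.
Proof.
move=> [ST minT] /andP[s_gt0 leT] t_gt0 sub; rewrite leqNgt; apply/negP => ltS.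
have := observed_mono (T - s) s_gt0 t_gt0 sub.
rewrite subnKC // ST subTset => /eqP S't.
by have [eqS _] := minT S' _ (ltnW ltS) S't; rewrite eqS ltnn in ltS.
Qed.

(** The head start of [S'] over [S] would be kept until the end, and [S'] would
    observe the whole graph before time [T]. *)
Lemma no_shortcut k (G : sgraph) (S S' : {set G}) T s t :
  optimal k S T -> #|S'| <= #|S| -> 0 < t < s -> s <= T ->
  ~~ (observed k S s \subset observed k S' t).
Proof.
move=> [ST minT] leS /andP[t_gt0 lt_ts] leT; apply/negP => sub.
have := observed_mono (T - s) (ltn_trans t_gt0 lt_ts) t_gt0 sub.
rewrite subnKC // ST subTset => /eqP S't.
have [_] := minT S' _ leS S't; rewrite leqNgt.
by rewrite -{2}(subnKC leT) ltn_add2r lt_ts.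
Qed.

(** * Recognizing small graphs *)

Lemma isomorphic_inv (G H : sgraph) (f : H -> G) :
  injective f -> #|G| <= #|H| -> (forall x y, adj (f x) (f y) = adj x y) ->
  isomorphic G H.
Proof.
move=> f_inj leGH f_adj; have [g fK gK] := inj_card_bij f_inj leGH.
exists g; first by exists f.
by move=> x y; rewrite -f_adj !gK.
Qed.

Lemma isomorphic_ord (G : sgraph) m (e : rel 'I_m) e_sym e_irr (s : seq G) x0 :
  #|G| = m -> size s = m -> uniq s ->
  (forall i j : 'I_m, i < j -> adj (nth x0 s i) (nth x0 s j) = e i j) ->
  isomorphic G (@SGraph 'I_m e e_sym e_irr).
Proof.
move=> cardG size_s uniq_s s_adj.
apply: (@isomorphic_inv G (SGraph e_sym e_irr) (fun i : 'I_m => nth x0 s i)).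
- by move=> i j /eqP; rewrite nth_uniq ?size_s // => /eqP/val_inj.
- by rewrite cardG card_ord.
move=> i j; have [/s_adj//|/s_adj ji|/val_inj ->] := ltngtP i j.
  by rewrite adj_sym ji; exact: e_sym.
by rewrite adj_irrefl; symmetry; exact: e_irr.
Qed.

(** * Two sources *)

(** The single vertex [v] observed first is adjacent to only one source [a]
    (otherwise [v] alone would do) and the sources are not adjacent (otherwise
    [a] alone would do). So the other source [b] is isolated, and starting from
    [v] instead of [a] is faster unless [T <= 1]. *)
Lemma two_sources_isomorphic k (G : sgraph) (S : {set G}) T :
  optimal k S T -> #|S| = 2 -> T + 2 = #|G| ->
  isomorphic G (disjoint_union (complete_graph 1) (complete_graph 1)) \/
  isomorphic G (disjoint_union (complete_graph 1) (complete_graph 2)).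
Proof.
move=> opt card2 cardG; case: T => [|T] in opt cardG *.
  left; have /cards2P[a [b [ab DS]]] : #|S| == 2 by apply/eqP.
  have inS z : z \in S by rewrite (proj1 opt : S = setT) inE.
  have nab : ~~ adj a b.
    apply/negP => adj_ab; have sub : observed k [set a] 1 = setT.
      apply/setP => z; rewrite in_observed1 !inE.
      have := inS z; rewrite DS !inE.
      by case/orP=> [->|/eqP->]; rewrite ?adj_ab ?orbT.
    by have [] := (proj2 opt) _ _ _ sub; rewrite ?DS ?cards1 ?cards2 ab.
  pose f (x : disjoint_union (complete_graph 1) (complete_graph 1)) : G :=
    if x is inl _ then a else b.
  apply: (@isomorphic_inv _ _ f).
  - move=> [i|i] [j|j] /= E; rewrite ?[i]ord1 ?[j]ord1 //;
      by rewrite E eqxx in ab.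
  - by rewrite -cardG card_sum !card_ord.
  move=> [i|i] [j|j]; rewrite /= ?adj_irrefl ?(negbTE nab) //.
  - by rewrite /complete_adj [i]ord1 [j]ord1 eqxx.
  - by rewrite adj_sym (negbTE nab).
  - by rewrite /complete_adj [i]ord1 [j]ord1 eqxx.
right.
have card3 : #|observed k S 1| = #|observed k S 0|.+1.
  apply/eqP; rewrite eqn_leq (optimal_growth opt) // andbT.
  by rewrite [X in _ <= X.+1]card2 (optimal_card_le (t := 1) opt).
have [v vS D1] := observed_grow1 card3.
have {}vS : v \notin S := vS.
have {}D1 : observed k S 1 = v |: S := D1.
have [a [b [ab DS av]]] : exists a b, [/\ a != b, S = [set a; b] & adj a v].
  have /cards2P[a [b [ab DS]]] : #|S| == 2 by apply/eqP.
  have : v \in observed k S 1 by rewrite D1 setU11.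
  rewrite in_closed_neighborhood (negbTE vS) => /exists_inP[s].
  rewrite DS !inE => /orP[] /eqP-> sv; first by exists a, b.
  by exists b, a; rewrite eq_sym setUC.
have single c : ~~ (observed k S 1 \subset observed k [set c] 1).
  apply/negP => /(no_smaller opt (t := 1)).
  by rewrite card2 cards1; move/(_ isT isT).
have nvb : ~~ adj v b.
  apply: contra (single v) => vb; rewrite D1 DS; apply/subsetP => z.
  rewrite in_observed1 !inE => /or3P[->|/eqP->|/eqP->] //;
    by rewrite ?vb ?(adj_sym v a) ?av ?orbT.
have nab : ~~ adj a b.
  apply: contra (single a) => adj_ab; rewrite D1 DS; apply/subsetP => z.
  rewrite in_observed1 !inE => /or3P[/eqP->|->|/eqP->] //;
    by rewrite ?adj_ab ?av ?orbT.
have b_isolated z : ~~ adj b z.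
  apply/negP => bz.
  have : z \in observed k S 1.
    by apply: adj_observed1 bz; rewrite DS !inE eqxx orbT.
  rewrite D1 DS !inE => /or3P[]/eqP Dz; rewrite Dz ?adj_irrefl // adj_sym in bz.
  - by rewrite bz in nvb.
  - by rewrite bz in nab.
case: T => [|T] in opt cardG *; last first.
  have vb : v != b by apply: contraNneq vS => ->; rewrite DS !inE eqxx orbT.
  have leS : #|[set v; b]| <= #|S| by rewrite card2 cards2 vb.
  have /negP[] := no_shortcut opt leS (s := 2) (t := 1) isT isT.
  have in1 z : z \in observed k S 1 -> z \in observed k [set v; b] 1.
    rewrite D1 DS => /setU1P[->|/set2P[]->].
    - by apply: sub_observed1; rewrite !inE eqxx.
    - by apply: (@adj_observed1 _ _ _ v); rewrite ?inE ?eqxx // adj_sym.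
    - by apply: sub_observed1; rewrite !inE eqxx orbT.
  apply/subsetP => z z2; have [/in1//|nz] := boolP (z \in observed k S 1).
  have [y [y1 yz _]] := observed_newP (isT : 0 < 1) z2 nz.
  move: y1; rewrite D1 DS => /setU1P[Dy|/set2P[]Dy]; rewrite Dy in yz.
  - by apply: adj_observed1 yz; rewrite !inE eqxx.
  - by case/negP: nz; apply: adj_observed1 yz; rewrite DS !inE eqxx.
  - by rewrite (negbTE (b_isolated z)) in yz.
pose f (x : disjoint_union (complete_graph 1) (complete_graph 2)) : G :=
  match x with inl _ => b | inr i => if i == ord0 then a else v end.
have va : v != a by apply: contraNneq vS => ->; rewrite DS !inE eqxx.
have vb : v != b by apply: contraNneq vS => ->; rewrite DS !inE eqxx orbT.
have ord2 (i : 'I_2) : i = ord0 \/ i = ord_max.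
  by case: i => [[|[|//]] lti]; [left|right]; apply: val_inj.
apply: (@isomorphic_inv _ _ f).
- move=> [i|i] [j|j]; rewrite /f ?[i]ord1 ?[j]ord1 //.
  + by case: ifP => _ E; rewrite E eqxx in ab vb.
  + by case: ifP => _ E; rewrite E eqxx in ab vb.
  + by case: (ord2 i) (ord2 j) => -> [] -> //= E; rewrite E eqxx in va.
- by rewrite -cardG card_sum !card_ord.
move=> [i|i] [j|j]; rewrite /= ?(negbTE (b_isolated _)) //.
- by rewrite /complete_adj [i]ord1 [j]ord1 eqxx.
- by rewrite adj_sym (negbTE (b_isolated _)).
- by case: (ord2 i) (ord2 j) => -> [] -> /=; rewrite ?adj_irrefl // adj_sym.
Qed.

(** * One source *)

(** The domination step observes one or two vertices. It observes two if it is
    the only step, as there are then three vertices. Otherwise a single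
    neighbor of [a] would dominate everything that [a] observes in two steps,
    and would be a better source. *)
Lemma one_source_degree2 k (G : sgraph) (a : G) T :
  optimal k [set a] T -> T + 2 = #|G| ->
  exists p q, uniq [:: a; p; q] /\ observed k [set a] 1 = [set a; p; q].
Proof.
move=> opt cardG.
have T_gt0 : 0 < T.
  case: T => // in opt cardG *; have := cards1 a.
  by rewrite (proj1 opt : [set a] = setT) cardsT -cardG.
have lt1 := optimal_growth opt T_gt0; rewrite {1}/observed cards1 in lt1.
have le3 := optimal_card_le opt cardG T_gt0.
have aS1 : a \in observed k [set a] 1 by rewrite in_observed1 eqxx.
have cardD : #|observed k [set a] 1 :\ a| = #|observed k [set a] 1|.-1.
  by rewrite (cardsD1 a (observed k [set a] 1)) aS1.
have D1 := setD1K aS1.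
case: (ltnP 2 #|observed k [set a] 1|) => [gt2|le2].
  have /cards2P[p [q [pq Dpq]]] : #|observed k [set a] 1 :\ a| == 2.
    by rewrite cardD; case: #|_| le3 gt2 => [|[|[|[|]]]].
  exists p, q; rewrite -D1 Dpq setUA; split=> //.
  have : a \notin [set p; q] by rewrite -Dpq !inE eqxx.
  by rewrite /= !inE pq !andbT.
have /cards1P[v Dv] : #|observed k [set a] 1 :\ a| == 1.
  by rewrite cardD; case: #|_| lt1 le2 => [|[|[|]]].
rewrite Dv in D1.
have T_gt1 : 1 < T.
  rewrite ltn_neqAle T_gt0 andbT; apply/eqP => T1; rewrite -T1 in opt cardG.
  by move: le2; rewrite (proj1 opt) cardsT -cardG.
have av : adj a v.
  have : v \in observed k [set a] 1 :\ a by rewrite Dv set11.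
  by rewrite in_setD1 in_observed1 => /andP[/negbTE->].
have /negP[] : ~~ (observed k [set a] 2 \subset observed k [set v] 1).
  by apply: (no_shortcut opt); rewrite ?cards1.
have sub1 z : z \in observed k [set a] 1 -> z \in observed k [set v] 1.
  by rewrite -D1 in_observed1 adj_sym => /set2P[]->; rewrite ?eqxx // av orbT.
apply/subsetP => z z2; have [/sub1//|nz] := boolP (z \in observed k [set a] 1).
have [y [y1 yz _]] := observed_newP (isT : 0 < 1) z2 nz.
move: y1; rewrite -D1 => /set2P[] Dy; rewrite Dy in yz.
  by rewrite in_observed1 yz orbT in nz.
by rewrite in_observed1 yz orbT.
Qed.

(** Of the two neighbors of [a], the one that forces [w] is named [p]: all its
    neighbors are observed at time 2, which leaves it [a], [q] and [w] only. *)
Lemma one_source_step2 k (G : sgraph) (a : G) T :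
  optimal k [set a] T -> T + 2 = #|G| -> 1 < T ->
  exists p q w, [/\ uniq [:: a; p; q; w],
    observed k [set a] 1 = [set a; p; q],
    observed k [set a] 2 = [set a; p; q; w],
    adj p w & forall z, adj p z -> z \in observed k [set a] 2].
Proof.
move=> opt cardG T_gt1; have [p [q [Upq D1]]] := one_source_degree2 opt cardG.
have card1 : #|observed k [set a] 1| = 3.
  rewrite D1 -setUA !cardsU1 cards1 !inE.
  by move: Upq; rewrite /= !inE => /and3P[-> ->].
have card2 : #|observed k [set a] 2| = #|observed k [set a] 1|.+1.
  apply/eqP; rewrite eqn_leq (optimal_growth opt T_gt1) andbT card1.
  exact: (optimal_card_le opt cardG T_gt1).
have [w nw D2] := observed_grow1 card2.
have [y [y1 yw le_k]] : exists v, [/\ v \in observed k [set a] 1, adj v w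
              & #|neighbors v :\: observed k [set a] 1| <= k].
  by apply: (observed_newP (isT : 0 < 1)) nw; rewrite D2 setU11.
have y2 z : adj y z -> z \in observed k [set a] 2.
  move=> yz; rewrite observedS //; exact: mem_propagate yz le_k.
have {}D2 : observed k [set a] 2 = [set a; p; q; w] by rewrite D2 D1 setUC.
move: nw; rewrite D1 !inE -orbA !negb_or => /and3P[wa wp wq].
move: Upq; rewrite /= !inE negb_or => /and3P[/andP[ap aq] pq _].
have ya : y != a.
  apply: contraTneq y1 => ya; apply: contra wa => _.
  have : w \in observed k [set a] 1 by rewrite in_observed1 -ya yw orbT.
  by rewrite D1 !inE -orbA (negbTE wp) (negbTE wq) !orbF.
move: y1; rewrite D1 !inE (negbTE ya) => /orP[]/eqP Dy; rewrite Dy in yw y2.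
  exists p, q, w; split=> //=; rewrite !inE !negb_or.
  by rewrite ap aq pq !(eq_sym _ w) wa wp wq.
exists q, p, w; split; rewrite ?(setUAC [set a] [set q]) //.
by rewrite /= !inE !negb_or ap aq (eq_sym q p) pq !(eq_sym _ w) wa wp wq.
Qed.

(** Otherwise a fifth vertex [x] is observed at time 3, necessarily by [q] or by
    [w]. In each case a source other than [a] observes [a], [p], [q], [w] and
    [x] in two steps:
    - if [q] observes [x], it had two unobserved neighbors [w] and [x] at time
      1; then [q] dominates [a], [w], [x], and [a] forces [p];
    - if [w] observes [x] and is adjacent to [q], then [w] dominates [p], [q],
      [x], and [p] forces [a];
    - if [w] observes [x] and is not adjacent to [q], then [p] dominates [a] and
      [w], which force [q] and [x] respectively. *)
Lemma one_source_ppt_le2 k (G : sgraph) (a : G) T :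
  0 < k -> optimal k [set a] T -> T + 2 = #|G| -> T <= 2.
Proof.
move=> k_gt0 opt cardG; rewrite leqNgt; apply/negP => T_gt2.
have [p [q [w [U D1 D2 pw p2]]]] := one_source_step2 opt cardG (ltnW T_gt2).
have card2 : #|observed k [set a] 2| = 4.
  suff -> : observed k [set a] 2 = [set z in [:: a; p; q; w]].
    by rewrite cardsE (card_uniqP U).
  by rewrite D2; apply/setP => z; rewrite !inE -!orbA.
have [x nx D3] : exists2 x, x \notin observed k [set a] 2
    & observed k [set a] 3 = x |: observed k [set a] 2.
  apply: observed_grow1; apply/eqP.
  rewrite eqn_leq (optimal_growth opt) // card2.
  by rewrite (optimal_card_le (t := 3) opt).
have [y [y2 yx le_k]] : exists v, [/\ v \in observed k [set a] 2, adj v x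
              & #|neighbors v :\: observed k [set a] 2| <= k].
  by apply: (observed_newP (isT : 0 < 2)) nx; rewrite D3 setU11.
have y3 z : adj y z -> z \in observed k [set a] 3.
  by move=> yz; rewrite observedS //; apply: mem_propagate yz le_k.
have shortcut c : let X := observed k [set c] 2 in
    ~ [/\ a \in X, p \in X, q \in X, w \in X & x \in X].
  move=> X [aX pX qX wX xX].
  have /negP[] : ~~ (observed k [set a] 3 \subset observed k [set c] 2).
    by apply: (no_shortcut opt); rewrite ?cards1.
  by rewrite D3 D2 !subUset !sub1set aX pX qX wX xX.
have sub12 (c z : G) : z \in observed k [set c] 1 -> z \in observed k [set c] 2.
  by apply/subsetP; exact: observed_subS.
have force (c v z : G) : v \in observed k [set c] 1 -> adj v z ->
    (forall z', adj v z' -> z' \notin observed k [set c] 1 -> z' = z) ->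
    z \in observed k [set c] 2.
  by move=> v1 vz only_z; rewrite observedS //; apply: mem_propagate1 only_z.
have aE z : (z == a) || adj a z = [|| z == a, z == p | z == q].
  by rewrite -(in_observed1 k) D1 !inE -orbA.
have {}p2 z : adj p z -> [|| z == a, z == p, z == q | z == w].
  by move/p2; rewrite D2 !inE -!orbA.
have {}y3 z : adj y z -> [|| z == x, z == a, z == p, z == q | z == w].
  by move/y3; rewrite D3 D2 !inE -!orbA.
have nx' : [&& x != a, x != p, x != q & x != w].
  by move: nx; rewrite D2 !inE !negb_or -!andbA.
move: U; rewrite /= !inE !negb_or -!andbA.
case/and5P=> ap aq aw pq /and3P[pw' qw _].
have ap_adj : adj a p by have := aE p; rewrite eqxx orbT eq_sym (negbTE ap).
have aq_adj : adj a q by have := aE q; rewrite eqxx !orbT eq_sym (negbTE aq).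
case/and4P: nx' => xa xp xq xw.
move: y2; rewrite D2 !inE -!orbA => /or4P[] /eqP Dy; subst y.
- by have := aE x; rewrite yx orbT (negbTE xa) (negbTE xp) (negbTE xq).
- by have := p2 x yx; rewrite (negbTE xa) (negbTE xp) (negbTE xq) (negbTE xw).
- (* If [w] were not a neighbor of [q], the set of unobserved neighbors of [q]
     would be the same at times 1 and 2, and [x] would be observed at time 2. *)
  have qw_adj : adj q w.
    apply: contraNT nx => nqw; rewrite observedS //.
    apply: (mem_propagate _ yx); first by rewrite D1 !inE eqxx orbT.
    apply: leq_trans le_k; apply/subset_leq_card/subsetP => z.
    case/setDP=> qz nz; apply/setDP; split=> //.
    rewrite D2 -D1 in_setU (negbTE nz) in_set1 /=.
    by apply: contraNneq nqw => <-; rewrite inE in qz.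
  apply: (shortcut q); split.
  + by apply: sub12; rewrite in_observed1 adj_sym aq_adj orbT.
  + apply: (force _ a) => // [|z'].
      by rewrite in_observed1 adj_sym aq_adj orbT.
    move=> az; have := aE z'; rewrite az orbT => /esym/or3P[]/eqP-> //.
      by rewrite in_observed1 adj_sym aq_adj orbT.
    by rewrite in_observed1 eqxx.
  + by apply: sub12; rewrite in_observed1 eqxx.
  + by apply: sub12; rewrite in_observed1 qw_adj orbT.
  + by apply: sub12; rewrite in_observed1 yx orbT.
have [wq_adj|nwq] := boolP (adj w q).
  have N z : [|| z == p, z == q, z == w | z == x] -> z \in observed k [set w] 1.
    rewrite in_observed1 => /or4P[]/eqP->; rewrite ?eqxx ?wq_adj ?yx ?orbT //.
    by rewrite adj_sym pw orbT.
  apply: (shortcut w); split.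
  + apply: (force _ p) => [||z' pz' nz']; first by rewrite N ?eqxx.
      by rewrite adj_sym.
    have /or4P[/eqP//|zp|zq|zw] := p2 z' pz';
      by rewrite N ?zp ?zq ?zw ?orbT in nz'.
  + by apply/sub12/N; rewrite eqxx.
  + by apply/sub12/N; rewrite eqxx orbT.
  + by apply/sub12/N; rewrite eqxx !orbT.
  + by apply/sub12/N; rewrite eqxx !orbT.
have N z : [|| z == a, z == p | z == w] -> z \in observed k [set p] 1.
  rewrite in_observed1 => /or3P[]/eqP->; rewrite ?eqxx ?pw ?orbT //.
  by rewrite adj_sym ap_adj orbT.
apply: (shortcut p); split.
- by apply/sub12/N; rewrite eqxx.
- by apply/sub12/N; rewrite eqxx orbT.
- apply: (force _ a) => // [|z' az' nz']; first by rewrite N ?eqxx.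
  have := aE z'; rewrite az' orbT => /esym/or3P[za|zp|/eqP//];
    by rewrite N ?za ?zp ?orbT in nz'.
- by apply/sub12/N; rewrite eqxx !orbT.
apply: (force _ w) => // [|z' wz' nz']; first by rewrite N ?eqxx ?orbT.
have /or4P[/eqP//|za|zp|/orP[/eqP zq|zw]] := y3 z' wz'.
- by rewrite N ?za in nz'.
- by rewrite N ?zp ?orbT in nz'.
- by rewrite -zq wz' in nwq.
- by rewrite N ?zw ?orbT in nz'.
Qed.

(** * Graphs with propagation time two less than their order *)

Theorem theorem32 (k : nat) (G : sgraph) (n : nat) (hk : 1 <= k)
    (hn : #|G| = n) (hppt : ppt k G + 2 = n) :
  isomorphic G (disjoint_union (complete_graph 1) (complete_graph 1)) \/
  isomorphic G (disjoint_union (complete_graph 1) (complete_graph 2)) \/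
  isomorphic G (path_graph 3) \/
  isomorphic G (path_graph 4) \/
  isomorphic G (cycle_graph 3) \/
  isomorphic G (cycle_graph 4).
Proof.
have [S opt] := ppt_optimal k G; set T := ppt k G in opt hppt.
have cardG : T + 2 = #|G| by rewrite hn.
have leS : #|S| <= 2 by exact: (optimal_card_le (t := 0) opt).
have S_gt0 : 0 < #|S|.
  rewrite lt0n cards_eq0; apply: contraL (isT : 0 < 2) => /eqP S0.
  (* The empty set observes nothing, while G has at least two vertices. *)
  have St t : observed k S t = set0.
    rewrite (@observed_stable _ _ _ 0) //= S0; apply/setP => z.
    rewrite in_closed_neighborhood inE.
    by apply/exists_inP => -[s]; rewrite inE.
  have := cardsT G; rewrite -(proj1 opt) St cards0 -cardG.
  by rewrite addnC.
have [S2|S_neq2] := eqVneq #|S| 2.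
  by have := two_sources_isomorphic opt S2 cardG; tauto.
have /cards1P[a DS] : #|S| == 1 by case: #|S| S_gt0 leS S_neq2 => [|[|[|]]].
rewrite {S}DS in opt leS S_gt0 S_neq2.
have leT := one_source_ppt_le2 hk opt cardG.
have [p [q [U D1]]] := one_source_degree2 opt cardG.
have aE z : (z == a) || adj a z = [|| z == a, z == p | z == q].
  by rewrite -(in_observed1 k) D1 !inE -orbA.
have ap : adj a p.
  have := aE p; rewrite eqxx orbT.
  by case: eqP U => // ->; rewrite /= !inE eqxx.
have aq : adj a q.
  have := aE q; rewrite eqxx !orbT.
  by case: eqP U => // ->; rewrite /= !inE eqxx orbT.
have [T_gt1|T_le1] := ltnP 1 T; last first.
  have G3 : #|G| = 3.
    apply/eqP; rewrite eqn_leq; apply/andP; split.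
      by rewrite -cardG (leq_add2r 2 T 1).
    by rewrite -[3](card_uniqP U) max_card.
  have [pq|npq] := boolP (adj p q).
    do 4!right; left; apply: (@isomorphic_ord G 3 _ _ _ [:: a; p; q] a) => //.
    case=> [[|[|[|?]]] // ?] [[|[|[|?]]] // ?] //= _;
      by rewrite ?ap ?aq ?pq /cycle_adj -?val_eqE.
  right; right; left.
  apply: (@isomorphic_ord G 3 _ _ _ [:: p; a; q] a) => //.
    move: U; rewrite /= !inE !negb_or (eq_sym p a).
    by case/and3P=> /andP[-> ->] ->.
  case=> [[|[|[|?]]] // ?] [[|[|[|?]]] // ?] //= _;
    by rewrite ?(negbTE npq) // adj_sym ap.
have {U p q D1 aE ap aq} [p [q [w [U D1 D2 pw _]]]] :=
  one_source_step2 opt cardG T_gt1.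
have aE z : (z == a) || adj a z = [|| z == a, z == p | z == q].
  by rewrite -(in_observed1 k) D1 !inE -orbA.
have G4 : #|G| = 4.
  apply/eqP; rewrite eqn_leq; apply/andP; split.
    by rewrite -cardG (leq_add2r 2 T 2).
  by rewrite -[4](card_uniqP U) max_card.
have := U; rewrite /= !inE !negb_or -!andbA.
case/and5P=> nap naq naw npq /and3P[npw nqw _].
have ap : adj a p by have := aE p; rewrite eqxx orbT eq_sym (negbTE nap).
have aq : adj a q by have := aE q; rewrite eqxx !orbT eq_sym (negbTE naq).
have aw : adj a w = false.
  have := aE w; rewrite eq_sym (negbTE naw) eq_sym (negbTE npw).
  by rewrite eq_sym (negbTE nqw).
(* Otherwise [p] would dominate all four vertices in a single step. *)
have pq : adj p q = false.
  have leS1 : #|[set p]| <= #|[set a]| by rewrite !cards1.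
  apply: contraTF (no_shortcut opt leS1 (isT : 0 < 1 < 2) T_gt1) => pq.
  rewrite negbK D2; apply/subsetP => z.
  rewrite in_observed1 !inE -!orbA => /or4P[]/eqP->;
    by rewrite ?eqxx ?pq ?pw ?(adj_sym p a) ?ap ?orbT.
have [qw|/negbTE qw] := boolP (adj q w).
  do 5!right; apply: (@isomorphic_ord G 4 _ _ _ [:: a; p; w; q] a) => //.
    by rewrite /= !inE !negb_or nap naw naq npw npq eq_sym nqw.
  case=> [[|[|[|[|?]]]] // ?] [[|[|[|[|?]]]] // ?] //= _;
    rewrite ?ap ?aw ?aq ?pw ?pq /cycle_adj -?val_eqE //.
  by rewrite adj_sym qw.
do 3!right; left; apply: (@isomorphic_ord G 4 _ _ _ [:: q; a; p; w] a) => //.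
  by rewrite /= !inE !negb_or !(eq_sym q) naq npq nap naw npw eq_sym nqw.
case=> [[|[|[|[|?]]]] // ?] [[|[|[|[|?]]]] // ?] //= _;
  rewrite ?ap ?aw ?pw ?qw //.
- by rewrite adj_sym aq.
- by rewrite adj_sym pq.
Qed.
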